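(* Let $a,b,c,d\in\mathbb{C}$ with $ad-bc=1$, $a+d=\pm2$ and $c\neq0$, let $g(z)=\frac{az+b}{cz+d}$, with fixed point $\alpha=\frac{a-d}{2c}$, and let $S_p=\{z\in\mathbb{C}:|z-p|=|\alpha-p|\}$ be a horocycle at $\alpha$ of $g$, where $p\ne\alpha$ satisfies $|p+\frac dc|=|p-\frac ac|$. For a point $z_0\in S_p\setminus\{\alpha\}$ denote $z_n=g^n(z_0)$ for $n\in\mathbb{Z}$. Then $$\lim_{n\to\pm\infty}z_n=\alpha.$$ Moreover, letting $\theta_n$ be the argument of $z_n-p$ chosen with $\mathrm{Arg}(\alpha-p)<\theta_n<\mathrm{Arg}(\alpha-p)+2\pi$, either $\theta_i<\theta_j$ for all integers $i<j$, or $\theta_i<\theta_j$ for all integers $i>j$.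
   Context: $\mathrm{Arg}$ is the principal argument, with values in $(-\pi,\pi]$. $g^n$ denotes the $n$-th iterate of $g$ on $\hat{\mathbb{C}}=\mathbb{C}\cup\{\infty\}$ (iterates of $g^{-1}$ for negative $n$), where $g(\infty)=a/c$, $g(-d/c)=\infty$. The points $z_n$ all lie in $S_p\setminus\{\alpha\}$, so that the arguments $\theta_n$ are well defined. *)

(* Defs.v *)
(* Stdlib real numbers, with Coquelicot's complex numbers and filters. *)
From Stdlib Require Export Reals ZArith.
From Coquelicot Require Export Coquelicot.
From Stdlib Require Import Lra Lia Psatz.

Open Scope C_scope.

(* The Riemann sphere: [Some z] is the finite point z, [None] is infinity. *)
Definition sphere : Type := option C.

(* The case [c = 0], where infinity is fixed, makes the definition meaningful
   for every invertible coefficient matrix. *)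
Definition moebius (a b c d : C) (x : sphere) : sphere :=
  match x with
  | None => if Ceq_dec c 0 then None else Some (a / c)
  | Some z => if Ceq_dec (c * z + d) 0 then None
              else Some ((a * z + b) / (c * z + d))
  end.

(* For ad - bc = 1; see [moebius_invK] and [moebiusK]. *)
Definition moebius_inv (a b c d : C) : sphere -> sphere :=
  moebius d (- b) (- c) a.

Definition moebius_iter (a b c d : C) (n : Z) (x : sphere) : sphere :=
  match n with
  | Z0 => x
  | Zpos k => Nat.iter (Pos.to_nat k) (moebius a b c d) x
  | Zneg k => Nat.iter (Pos.to_nat k) (moebius_inv a b c d) x
  end.

(* The circle S_p with centre p through alpha. *)
Definition on_circle (alpha p z : C) : Prop :=
  Cmod (z - p) = Cmod (alpha - p).

(* t is one of the arguments of w (defined modulo 2 pi). *)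
Definition is_arg (w : C) (t : R) : Prop :=
  w = (RtoC (Cmod w) * (cos t, sin t))%C.

(* The principal argument of w <> 0; see [Arg_is_arg] and [Arg_bounds]. *)
Definition Arg (w : C) : R :=
  if Rle_dec 0 (snd w) then acos (fst w / Cmod w) else (- acos (fst w / Cmod w))%R.

Lemma moebiusK (a b c d : C) (x : sphere) :
  a * d - b * c = 1 -> moebius_inv a b c d (moebius a b c d x) = x.
Proof.
intros H; unfold moebius_inv, moebius.
assert (n10 : RtoC 1 <> 0) by (intros E; apply RtoC_inj in E; lra).
destruct x as [z|].
- destruct (Ceq_dec (c * z + d) 0) as [E|E].
  + destruct (Ceq_dec (- c) 0) as [Ec|Ec].
    * exfalso; apply n10. assert (c0 : c = 0) by (replace c with (- - c) by ring; rewrite Ec; ring).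
      subst c. assert (d0 : d = 0) by (rewrite <- E; ring). rewrite <- H, d0; ring.
    * assert (c0 : c <> 0) by (intros Z; apply Ec; rewrite Z; ring).
      f_equal. replace d with ((c * z + d) - c * z) by ring. rewrite E. field; auto.
  + assert (F : - c * ((a * z + b) / (c * z + d)) + a = / (c * z + d)).
    { transitivity ((a * d - b * c) / (c * z + d)); [field; auto | rewrite H; field; auto]. }
    rewrite F. destruct (Ceq_dec (/ (c * z + d)) 0) as [G|G].
    * exfalso; apply n10. rewrite <- (Cinv_r (c * z + d)); auto. rewrite G; ring.
    * f_equal. transitivity ((a * d - b * c) * z); [|rewrite H; ring].
      field; auto.
- destruct (Ceq_dec c 0) as [E|E].
  + destruct (Ceq_dec (- c) 0) as [F|F]; auto. exfalso; apply F; rewrite E; ring.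
  + destruct (Ceq_dec (- c * (a / c) + a) 0) as [F|F]; auto.
    exfalso; apply F; field; auto.
Qed.

Lemma moebius_invK (a b c d : C) (x : sphere) :
  a * d - b * c = 1 -> moebius a b c d (moebius_inv a b c d x) = x.
Proof.
intros H. assert (K : d * a - - b * - c = 1) by (rewrite <- H; ring).
generalize (moebiusK d (- b) (- c) a x K); unfold moebius_inv.
replace (- - b) with b by ring; replace (- - c) with c by ring; auto.
Qed.

Lemma Arg_bounds (w : C) : w <> 0 -> (- PI < Arg w <= PI)%R.
Proof.
intros Hw. assert (m := Cmod_gt_0 w). assert (Hm : (0 < Cmod w)%R) by (apply m; auto).
unfold Arg. pose proof PI_RGT_0. pose proof (acos_bound (fst w / Cmod w)).
destruct (Rle_dec 0 (snd w)) as [E|E]; [lra|].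
split; [|lra].
destruct (Req_dec (acos (fst w / Cmod w)) PI) as [P|P]; [|lra].
exfalso.
assert (B : (-1 < fst w / Cmod w)%R).
{ apply Rmult_lt_reg_r with (Cmod w); auto. unfold Rdiv; rewrite Rmult_assoc, Rinv_l by lra.
  assert (S : (Cmod w * Cmod w = fst w * fst w + snd w * snd w)%R).
  { unfold Cmod. rewrite sqrt_sqrt; [ring|nra]. } nra. }
assert (B' : (fst w / Cmod w <= 1)%R).
{ apply Rmult_le_reg_r with (Cmod w); auto. unfold Rdiv; rewrite Rmult_assoc, Rinv_l by lra.
  pose proof (Rmax_Cmod w). pose proof (Rmax_l (Rabs (fst w)) (Rabs (snd w))).
  pose proof (Rle_abs (fst w)). lra. }
assert (Q := cos_acos (fst w / Cmod w)). rewrite P, cos_PI in Q. lra.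
Qed.

Lemma Arg_is_arg (w : C) : w <> 0 -> is_arg w (Arg w).
Proof.
intros Hw. assert (Hm : (0 < Cmod w)%R) by (apply Cmod_gt_0; auto).
assert (S : (Cmod w * Cmod w = fst w * fst w + snd w * snd w)%R).
{ unfold Cmod. rewrite sqrt_sqrt; [ring|nra]. }
set (u := (fst w / Cmod w)%R).
assert (Hu : (fst w = Cmod w * u)%R) by (unfold u; field; lra).
set (v := (snd w / Cmod w)%R).
assert (Hv : (snd w = Cmod w * v)%R) by (unfold v; field; lra).
assert (U : (u * u + v * v = 1)%R).
{ apply Rmult_eq_reg_l with (Cmod w * Cmod w)%R; [|nra].
  rewrite Rmult_1_r. rewrite S at 2. rewrite Hu, Hv. ring. }
assert (U1 : (-1 <= u <= 1)%R) by nra.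
assert (sg : (Cmod w * Rabs v = Rabs (snd w))%R).
{ rewrite Hv, Rabs_mult, (Rabs_pos_eq (Cmod w)); lra. }
assert (sn : sin (acos u) = Rabs v).
{ rewrite sin_acos by auto. rewrite <- sqrt_Rsqr_abs. f_equal. unfold Rsqr. lra. }
unfold is_arg, Arg; fold u.
destruct (Rle_dec 0 (snd w)) as [E|E].
- rewrite cos_acos, sn by auto.
  rewrite (Rabs_pos_eq (snd w)) in sg by auto.
  rewrite (surjective_pairing w) at 1. unfold Cmult, RtoC; simpl.
  f_equal; lra.
- rewrite cos_neg, sin_neg, cos_acos, sn by auto.
  rewrite (Rabs_left (snd w)) in sg by lra.
  rewrite (surjective_pairing w) at 1. unfold Cmult, RtoC; simpl.
  f_equal; lra.
Qed.

(* An argument in an open interval of length 2 pi is unique. *)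
Lemma is_arg_unique (w : C) (t s1 s2 : R) :
  w <> 0 -> is_arg w s1 -> is_arg w s2 ->
  (t < s1 < t + 2 * PI)%R -> (t < s2 < t + 2 * PI)%R -> s1 = s2.
Proof.
intros Hw H1 H2 B1 B2. assert (Hm : (0 < Cmod w)%R) by (apply Cmod_gt_0; auto).
unfold is_arg in H1, H2. rewrite H1 in H2 at 1.
unfold Cmult, RtoC in H2; simpl in H2. injection H2 as Hs Hc.
assert (Ec : cos s1 = cos s2) by (apply Rmult_eq_reg_l with (Cmod w); lra).
assert (Es : sin s1 = sin s2) by (apply Rmult_eq_reg_l with (Cmod w); lra).
assert (D : cos (2 * ((s1 - s2) / 2)) = 1%R).
{ replace (2 * ((s1 - s2) / 2))%R with (s1 - s2)%R by lra.
  rewrite cos_minus, Ec, Es. generalize (sin2_cos2 s2); unfold Rsqr; lra. }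
rewrite cos_2a_sin in D.
assert (Z : sin ((s1 - s2) / 2) = 0%R) by nra.
destruct (Rtotal_order s1 s2) as [L|[L|L]]; auto; exfalso.
- assert (0 < sin (- ((s1 - s2) / 2)))%R by (apply sin_gt_0; lra).
  rewrite sin_neg in H; lra.
- assert (0 < sin ((s1 - s2) / 2))%R by (apply sin_gt_0; lra). lra.
Qed.

(* Main.v *)
Require Import Defs.
From Stdlib Require Import Lra.

(** A parabolic Moebius map with fixed point [alpha] is conjugate to a
    translation by w = 1 / (z - alpha), and the circle through [alpha] with
    centre [p] becomes a line of the w-plane.  Scaling w by p - alpha turns
    this line into Re w = 1/2, so the circle minus [alpha] is the image of

      [horo alpha p] : t |-> alpha + (p - alpha) / (1/2 + i t),   t real.

    The horocycle condition says that p is equidistant from the points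
    alpha + h and alpha - h, where h = a/c - alpha; hence the translation
    vector (p - alpha) / h is purely imaginary and g acts on the parameter as
    t |-> t + kappa with a real [kappa] different from 0 ([moebius_horo]).
    Everything is then read off the arithmetic progression t0 + n kappa:

    - |horo t - alpha| <= |p - alpha| / |t| gives both limits ([horo_lim]);
    - (it - 1/2) / (it + 1/2) has modulus 1 and argument PI - 2 atan (2 t) in
      (0, 2 PI), so [Arg (alpha - p) + angle t] is the prescribed argument
      ([is_arg_horo]); as [angle] is decreasing, the arguments decrease with n
      when kappa > 0 and increase when kappa < 0. *)

(** * Complex numbers *)

Lemma RtoC_neq (x y : R) : x <> y -> RtoC x <> RtoC y.
Proof. now intros H E; apply H, RtoC_inj. Qed.

Lemma Cpair_neq0 (x y : R) : x <> 0%R -> ((x, y) : C) <> 0.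
Proof. now intros H E; injection E. Qed.

Lemma Cdiv_neq0 (x y : C) : x <> 0 -> y <> 0 -> x / y <> 0.
Proof.
intros Hx Hy E; apply Hx.
replace x with (x / y * y) by (field; exact Hy).
rewrite E; ring.
Qed.

(** The perpendicular bisector of the segment from -h to h is the line of
    imaginary multiples of h. *)
Lemma Re_div_equidistant (q h : C) :
  h <> 0 -> Cmod (q + h) = Cmod (q - h) -> Re (q / h) = 0%R.
Proof.
intros Hh E.
assert (S : (Cmod (q + h) ^ 2 = Cmod (q - h) ^ 2)%R) by now rewrite E.
rewrite !Cmod2_alt in S.
assert (P : (0 < Cmod h ^ 2)%R) by (apply pow_lt; now apply Cmod_gt_0).
rewrite Cmod2_alt in P.
destruct q as [q1 q2], h as [h1 h2]; unfold Re, Im in *; simpl in *.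
assert (D : (q1 * h1 + q2 * h2 = 0)%R) by nra.
transitivity ((q1 * h1 + q2 * h2) / (h1 * (h1 * 1) + h2 * (h2 * 1)))%R.
- field; lra.
- rewrite D; unfold Rdiv; ring.
Qed.

Lemma is_arg_Cmult (u v : C) (s t : R) :
  is_arg u s -> is_arg v t -> is_arg (u * v) (s + t).
Proof.
unfold is_arg; intros Hu Hv.
rewrite Hu, Hv at 1; rewrite Cmod_mult, cos_plus, sin_plus.
apply injective_projections; simpl; ring.
Qed.

(** * The parametrised circle *)

Definition horo (alpha p : C) (t : R) : C :=
  alpha + (p - alpha) / ((/ 2)%R, t).

Definition angle (t : R) : R := (PI - 2 * atan (2 * t))%R.

Lemma half_neq0 (t : R) : (((/ 2)%R, t) : C) <> 0.
Proof. apply Cpair_neq0; lra. Qed.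

Lemma angle_bounds (t : R) : (0 < angle t < 2 * PI)%R.
Proof. unfold angle; pose proof (atan_bound (2 * t)); lra. Qed.

Lemma angle_decreasing (s t : R) : (s < t)%R -> (angle t < angle s)%R.
Proof.
intros H; unfold angle.
assert (L : (atan (2 * s) < atan (2 * t))%R) by (apply atan_increasing; lra).
lra.
Qed.

(** With x = 2 t = tan y, the point exp (i (PI - 2 y)) = - exp (- 2 i y) is
    (i x - 1) / (i x + 1): the double-angle formulas for y = atan x. *)
Lemma exp_angle (t : R) :
  ((cos (angle t), sin (angle t)) : C) = (((- / 2)%R, t) : C) / ((/ 2)%R, t).
Proof.
set (x := (2 * t)%R).
assert (Q : (0 < 1 + x * x)%R) by nra.
assert (Hs : (sqrt (1 + x * x) * sqrt (1 + x * x) = 1 + x * x)%R)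
  by (apply sqrt_sqrt; lra).
assert (Hp : (0 < sqrt (1 + x * x))%R) by now apply sqrt_lt_R0.
assert (Hc : (cos (atan x) * cos (atan x) = / (1 + x * x))%R).
{ rewrite cos_atan; unfold Rsqr; rewrite <- Hs at 3; field; lra. }
assert (Hx : (sin (atan x) = x * cos (atan x))%R).
{ rewrite cos_atan, sin_atan; unfold Rsqr; field; lra. }
assert (Ec : (cos (angle t) = (x * x - 1) / (1 + x * x))%R).
{ unfold angle; fold x.
  rewrite Rtrigo_facts.cos_pi_minus, cos_2a, Hx.
  transitivity ((x * x - 1) * (cos (atan x) * cos (atan x)))%R; [ring|].
  now rewrite Hc. }
assert (Es : (sin (angle t) = 2 * x / (1 + x * x))%R).
{ unfold angle; fold x.
  rewrite Rtrigo_facts.sin_pi_minus, sin_2a, Hx.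
  transitivity (2 * x * (cos (atan x) * cos (atan x)))%R; [ring|].
  now rewrite Hc. }
rewrite Ec, Es; unfold x in *.
apply injective_projections; simpl; field; nra.
Qed.

Lemma horo_sub_center (alpha p : C) (t : R) :
  horo alpha p t - p = (alpha - p) * (cos (angle t), sin (angle t)).
Proof.
rewrite exp_angle; unfold horo.
pose proof (half_neq0 t) as H.
replace (((- / 2)%R, t) : C) with ((((/ 2)%R, t) : C) - 1)
  by (apply injective_projections; simpl; field).
field; exact H.
Qed.

Lemma Cmod_exp (t : R) : Cmod (cos t, sin t) = 1%R.
Proof.
unfold Cmod; simpl; transitivity (sqrt 1); [f_equal | apply sqrt_1].
generalize (sin2_cos2 t); unfold Rsqr; lra.
Qed.

Lemma horo_on_circle (alpha p : C) (t : R) : on_circle alpha p (horo alpha p t).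
Proof.
unfold on_circle; rewrite horo_sub_center, Cmod_mult, Cmod_exp; ring.
Qed.

Lemma horo_neq (alpha p : C) (t : R) : p <> alpha -> horo alpha p t <> alpha.
Proof.
intros Hp E; apply (Cdiv_neq0 (p - alpha) ((/ 2)%R, t)).
- intros Z; apply Hp; replace p with (p - alpha + alpha) by ring.
  rewrite Z; ring.
- apply half_neq0.
- replace ((p - alpha) / ((/ 2)%R, t)) with (horo alpha p t - alpha)
    by (unfold horo; ring).
  rewrite E; ring.
Qed.

(** With u = z - alpha and q = p - alpha, the circle equation says that
    q - u/2 is equidistant from -u/2 and u/2, hence Re (q / u) = 1/2. *)
Lemma on_circle_horo (alpha p z : C) :
  p <> alpha -> on_circle alpha p z -> z <> alpha ->
  exists t : R, z = horo alpha p t.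
Proof.
intros Hp Hz Ha; unfold on_circle in Hz.
assert (n2 : RtoC 2 <> 0) by (apply RtoC_neq; lra).
assert (Hu : z - alpha <> 0).
{ intros E; apply Ha; replace z with (z - alpha + alpha) by ring; rewrite E; ring. }
set (u := z - alpha) in *; set (q := p - alpha).
assert (Hq : q <> 0).
{ intros E; apply Hp; replace p with (q + alpha) by (unfold q; ring); rewrite E; ring. }
assert (D : Re ((q - u / 2) / (u / 2)) = 0%R).
{ apply Re_div_equidistant; [now apply Cdiv_neq0|].
  replace (q - u / 2 + u / 2) with (- (alpha - p)) by (unfold q, u; field; exact n2).
  replace (q - u / 2 - u / 2) with (- (z - p)) by (unfold q, u; field; exact n2).
  now rewrite !Cmod_opp. }
assert (E : q / u = ((/ 2)%R, Im (q / u))).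
{ replace ((q - u / 2) / (u / 2)) with (2 * (q / u) - 1) in D
    by (field; repeat split; assumption).
  destruct (q / u) as [x y]; unfold Re, Im in *; simpl in *.
  f_equal; lra. }
exists (Im (q / u)); unfold horo; rewrite <- E; fold q.
replace (q / (q / u)) with u by (field; repeat split; assumption).
unfold u; ring.
Qed.

Lemma is_arg_horo (alpha p : C) (t : R) :
  p <> alpha ->
  is_arg (horo alpha p t - p) (Arg (alpha - p) + angle t) /\
  (Arg (alpha - p) < Arg (alpha - p) + angle t < Arg (alpha - p) + 2 * PI)%R.
Proof.
intros Hp; split.
- rewrite horo_sub_center; apply is_arg_Cmult.
  + apply Arg_is_arg; intros E; apply Hp.
    replace p with (alpha - (alpha - p)) by ring; rewrite E; ring.
  + unfold is_arg; rewrite Cmod_exp; symmetry; apply Cmult_1_l.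
- pose proof (angle_bounds t); lra.
Qed.

Lemma horo_lim (alpha p : C) (t : nat -> R) :
  is_lim_seq (fun n => Rabs (t n)) p_infty ->
  filterlim (fun n => horo alpha p (t n)) eventually (locally alpha).
Proof.
intros Ht; apply filterlim_locally; intros eps.
set (r := Cmod (p - alpha)).
apply is_lim_seq_spec in Ht.
generalize (Ht (r / eps)%R); apply filter_imp; intros n Hn.
apply C_NormedModule_mixin_compat1.
replace (minus (horo alpha p (t n)) alpha) with ((p - alpha) / ((/ 2)%R, t n))
  by (unfold horo, minus, plus, opp; simpl; ring).
rewrite Cmod_div by apply half_neq0; fold r.
assert (L : (Rabs (t n) <= Cmod ((/ 2)%R, t n))%R)
  by (eapply Rle_trans; [apply Rmax_r | apply (Rmax_Cmod ((/ 2)%R, t n))]).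
assert (P : (0 < Cmod ((/ 2)%R, t n))%R) by (apply Cmod_gt_0, half_neq0).
pose proof (cond_pos eps) as He.
apply Rmult_lt_reg_r with (Cmod ((/ 2)%R, t n)); [exact P|].
unfold Rdiv; rewrite Rmult_assoc, Rinv_l, Rmult_1_r by lra.
replace r with (r / eps * eps)%R by (field; lra).
nra.
Qed.

Lemma is_lim_seq_abs_progression (t k : R) :
  k <> 0%R -> is_lim_seq (fun n => Rabs (t + INR n * k)) p_infty.
Proof.
intros Hk.
assert (L : is_lim_seq (fun n => INR n * k)%R (Rbar_mult p_infty k))
  by apply is_lim_seq_scal_r, is_lim_seq_INR.
destruct (Rdichotomy _ _ Hk) as [S|S].
- replace (Rbar_mult p_infty k) with m_infty in L
    by (simpl; destruct (Rle_dec 0 k); [exfalso; lra|reflexivity]).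
  apply (is_lim_seq_abs _ m_infty).
  now apply (is_lim_seq_plus _ _ t m_infty); [apply is_lim_seq_const| |].
- replace (Rbar_mult p_infty k) with p_infty in L
    by (simpl; destruct (Rle_dec 0 k) as [H|]; [|exfalso; lra];
        destruct (Rle_lt_or_eq_dec 0 k H); [reflexivity|exfalso; lra]).
  apply (is_lim_seq_abs _ p_infty).
  now apply (is_lim_seq_plus _ _ t p_infty); [apply is_lim_seq_const| |].
Qed.

(** * The action of the map on the parameter *)

(** Here [e] is half the trace, c alpha + d = e and e / c = a / c - alpha.
    For z = alpha + u the fixed-point equation gives
    g z = alpha + e u / (e + c u), that is 1 / (g z - alpha) = 1 / u + c / e. *)
Lemma moebius_horo (a b c d e alpha p : C) (kappa t : R) :
  a * d - b * c = 1 -> e * e = 1 -> c <> 0 ->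
  a = e + c * alpha -> d = e - c * alpha ->
  (p - alpha) / (e / c) = (0%R, kappa) ->
  moebius a b c d (Some (horo alpha p t)) = Some (horo alpha p (t + kappa)).
Proof.
intros Hdet He Hc Ha Hd Hk.
assert (n1 : RtoC 1 <> 0) by (apply RtoC_neq; lra).
assert (e0 : e <> 0) by (intros E; apply n1; rewrite <- He, E; ring).
set (q := p - alpha) in *.
set (s := (((/ 2)%R, t) : C)); set (s' := (((/ 2)%R, (t + kappa)%R) : C)).
assert (s0 : s <> 0) by apply half_neq0.
assert (s0' : s' <> 0) by apply half_neq0.
assert (Es : s' = s + c * q / e).
{ replace (c * q / e) with (q / (e / c)) by (field; repeat split; assumption).
  rewrite Hk; apply injective_projections; simpl; ring. }
assert (Eden : c * horo alpha p t + d = e * s' / s).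
{ unfold horo; fold q s; rewrite Es, Hd; field; repeat split; assumption. }
assert (Hb : b = - c * alpha * alpha).
{ replace b with ((a * d - (a * d - b * c)) / c) by (field; exact Hc).
  rewrite Hdet, <- He, Ha, Hd; field; exact Hc. }
assert (Enum : a * horo alpha p t + b = alpha * (e * s' / s) + e * q / s).
{ rewrite <- Eden, Ha, Hb, Hd; unfold horo; fold q s; field; exact s0. }
unfold moebius; rewrite Eden, Enum.
destruct (Ceq_dec (e * s' / s) 0) as [Z|_].
- exfalso; revert Z; apply Cdiv_neq0; [now apply Cmult_neq_0|exact s0].
- f_equal; unfold horo; fold q s s'; field; repeat split; assumption.
Qed.

Lemma moebius_iter_translation (a b c d : C) (f : R -> C) (kappa : R) :
  a * d - b * c = 1 ->
  (forall t, moebius a b c d (Some (f t)) = Some (f (t + kappa)%R)) ->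
  forall (n : Z) (t : R),
    moebius_iter a b c d n (Some (f t)) = Some (f (t + IZR n * kappa)%R).
Proof.
intros Hdet Hf.
assert (Hinv : forall t, moebius_inv a b c d (Some (f t)) = Some (f (t - kappa)%R)).
{ intros t; replace t with (t - kappa + kappa)%R at 1 by ring.
  rewrite <- Hf; now apply moebiusK. }
assert (It : forall (g : sphere -> sphere) (k : R),
          (forall t, g (Some (f t)) = Some (f (t + k)%R)) ->
          forall (m : nat) (t : R),
            Nat.iter m g (Some (f t)) = Some (f (t + INR m * k)%R)).
{ intros g k Hg m t; induction m as [|m IH].
  - simpl; do 2 f_equal; ring.
  - rewrite Nat.iter_succ, IH, Hg, S_INR; do 2 f_equal; ring. }
intros [|k|k] t; unfold moebius_iter.
- do 2 f_equal; ring.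
- rewrite (It _ kappa Hf), INR_IPR; reflexivity.
- rewrite (It _ (- kappa)%R Hinv), INR_IPR; do 2 f_equal.
  change (IZR (Z.neg k)) with (- IPR k)%R; ring.
Qed.

Theorem proposition3p6 (a b c d alpha p z0 : C)
  (hdet : a * d - b * c = 1)
  (htr : a + d = 2 \/ a + d = - 2)
  (hc : c <> 0)
  (halpha : alpha = (a - d) / (2 * c))
  (hp : p <> alpha)
  (hhoro : Cmod (p + d / c) = Cmod (p - a / c))
  (hz0 : on_circle alpha p z0)
  (hz0a : z0 <> alpha) :
  exists (z : Z -> C) (theta : Z -> R),
    (forall n : Z, moebius_iter a b c d n (Some z0) = Some (z n)) /\
    (forall n : Z, on_circle alpha p (z n) /\ z n <> alpha) /\
    filterlim (fun n : nat => z (Z.of_nat n)) eventually (locally alpha) /\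
    filterlim (fun n : nat => z (- Z.of_nat n)%Z) eventually (locally alpha) /\
    (forall n : Z, is_arg (z n - p) (theta n) /\
       (Arg (alpha - p) < theta n < Arg (alpha - p) + 2 * PI)%R) /\
    ((forall i j : Z, (i < j)%Z -> (theta i < theta j)%R) \/
     (forall i j : Z, (j < i)%Z -> (theta i < theta j)%R)).
Proof.
assert (n2 : RtoC 2 <> 0) by (apply RtoC_neq; lra).
assert (n1 : RtoC 1 <> 0) by (apply RtoC_neq; lra).
set (e := (a + d) / 2).
assert (He : e * e = 1)
  by (unfold e; destruct htr as [H|H]; rewrite H; field; exact n2).
assert (e0 : e <> 0) by (intros E; apply n1; rewrite <- He, E; ring).
assert (Ha : a = e + c * alpha) by (rewrite halpha; unfold e; field; repeat split; assumption).
assert (Hd : d = e - c * alpha) by (rewrite halpha; unfold e; field; repeat split; assumption).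
assert (h0 : e / c <> 0) by now apply Cdiv_neq0.
assert (q0 : p - alpha <> 0).
{ intros E; apply hp; replace p with (p - alpha + alpha) by ring; rewrite E; ring. }
set (kappa := Im ((p - alpha) / (e / c))).
assert (Hk : (p - alpha) / (e / c) = (0%R, kappa)).
{ apply injective_projections; [|reflexivity].
  apply (Re_div_equidistant _ _ h0).
  replace (p - alpha + e / c) with (p + d / c) by (rewrite Hd; field; exact hc).
  replace (p - alpha - e / c) with (p - a / c) by (rewrite Ha; field; exact hc).
  exact hhoro. }
assert (k0 : kappa <> 0%R).
{ intros E; apply (Cdiv_neq0 _ _ q0 h0); rewrite Hk, E; reflexivity. }
destruct (on_circle_horo alpha p z0 hp hz0 hz0a) as [t0 ->].
exists (fun n => horo alpha p (t0 + IZR n * kappa)).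
exists (fun n => Arg (alpha - p) + angle (t0 + IZR n * kappa))%R.
split; [|split; [|split; [|split; [|split]]]].
- intros n; apply (moebius_iter_translation _ _ _ _ (horo alpha p)); [exact hdet|].
  intros t; now apply (moebius_horo a b c d e).
- intros n; split; [apply horo_on_circle|now apply horo_neq].
- apply horo_lim.
  apply is_lim_seq_ext with (fun n => Rabs (t0 + INR n * kappa)).
  + intros n; now rewrite INR_IZR_INZ.
  + now apply is_lim_seq_abs_progression.
- apply horo_lim.
  apply is_lim_seq_ext with (fun n => Rabs (t0 + INR n * - kappa)).
  + intros n; rewrite opp_IZR, <- INR_IZR_INZ; f_equal; ring.
  + apply is_lim_seq_abs_progression; lra.
- intros n; now apply is_arg_horo.
- destruct (Rdichotomy _ _ k0) as [L|L]; [left|right];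
    intros i j H; apply Rplus_lt_compat_l, angle_decreasing;
    apply IZR_lt in H; nra.
Qed.
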